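(* For any triangle tiling billiard the following holds. (i) The period of any periodic trajectory belongs to the set $\{4n+2 \mid n\in\mathbb{N}^*\}$. (ii) The symbolic code $w\in\{a,b,c\}^{\mathbb{N}}$ of any periodic trajectory has its smallest period $s$ (a finite word in $\{a,b,c\}$) of odd length; a complete period of the periodic trajectory is then described by the word $s^2=ss$, and $w=\overline{s^2}$.
   Context: A periodic triangle tiling is a tiling of the Euclidean plane by congruent triangles with sides labelled $a,b,c$, such that any two tiles sharing a side are centrally symmetric to each other with respect to the midpoint of that side. The triangle tiling billiard on it: a point moves along a straight line inside each tile; when it reaches an interior point of an edge it passes to the neighbouring tile across this edge, with refraction according to Snell's law with coefficient $-1$, i.e. the new direction vector keeps the component normal to the edge and reverses the component tangent to the edge. Trajectories avoid the vertices of the tiling. A trajectory is periodic if it is a closed curve; its period is the number of edges it crosses before closing up. The symbolic code of an oriented trajectory is the sequence of labels of the sides it crosses; for a periodic trajectory it is viewed as an infinite periodic word, and $\overline{u}$ denotes the infinite word $uuu\ldots$. A complete period is the word of labels of edges crossed during one full tour of the closed trajectory. $\mathbb{N}^*=\{1,2,3,\ldots\}$. *)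

(* Defs.v *)
From mathcomp Require Import all_boot all_order all_algebra.
From mathcomp Require Import all_classical all_reals.

Set Implicit Arguments.
Unset Strict Implicit.
Unset Printing Implicit Defensive.

Import Order.TTheory GRing.Theory Num.Theory.

Local Open Scope classical_set_scope.
Local Open Scope ring_scope.

(* The side labels a, b, c are the three elements of 'I_3; arithmetic on labels
   is modulo 3. *)
Notation label := 'I_3.

Notation plane R := 'rV[R]_2.

(* A labelled triangle is given by its vertices, [V l] being the vertex opposite
   to the side labelled [l]. *)
Notation tile R := (label -> plane R).

Section Geometry.
Variable R : realType.
Implicit Types (V W : tile R) (x y u v : plane R) (l m : label).

Definition dot u v : R := \sum_i u 0 i * v 0 i.

Definition enorm u : R := Num.sqrt (dot u u).

Definition isometry (g : plane R -> plane R) : Prop :=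
  forall x y, enorm (g x - g y) = enorm (x - y).

Definition congruent V W : Prop :=
  exists2 g : plane R -> plane R, isometry g & forall l, W l = g (V l).

Definition nondegenerate V : Prop :=
  forall k : label -> R, \sum_l k l = 0 -> \sum_l k l *: V l = 0 ->
    forall l, k l = 0.

Definition barycentric V (k : label -> R) x : Prop :=
  \sum_l k l = 1 /\ x = \sum_l k l *: V l.

Definition triangle V : set (plane R) :=
  [set x | exists2 k, barycentric V k x & forall l, 0 <= k l].

Definition open_triangle V : set (plane R) :=
  [set x | exists2 k, barycentric V k x & forall l, 0 < k l].

Definition side V l : set (plane R) :=
  [set x | exists2 k, barycentric V k x & k l = 0 /\ forall m, 0 <= k m].

Definition open_side V l : set (plane R) :=
  [set x | exists2 k, barycentric V k x &
             k l = 0 /\ forall m, m != l -> 0 < k m].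

Definition midpoint V l : plane R := 2^-1 *: (V (l + 1) + V (l - 1)).

Definition side_vector V l : plane R := V (l + 1) - V (l - 1).

Definition central_symmetry (c x : plane R) : plane R := 2 *: c - x.

(* [W] is another tile, one of whose sides is the side [l] of [V]. *)
Definition neighbour V l W : Prop :=
  W <> V /\ exists m, side W m = side V l.

(* Tiles are labelled triangles: congruences and central symmetries respect the
   labels, which matters for isosceles and equilateral tiles only. *)
Record periodic_triangle_tiling (tau : set (tile R)) : Prop := {
  tiling_nondegenerate : forall V, tau V -> nondegenerate V;
  tiling_congruent : forall V W, tau V -> tau W -> congruent V W;
  tiling_cover : forall x, exists2 V, tau V & triangle V x;
  tiling_disjoint : forall V W, tau V -> tau W -> V <> W ->
    open_triangle V `&` open_triangle W = set0;
  tiling_edge_to_edge : forall V W, tau V -> tau W ->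
    forall l, triangle V (W l) -> exists m, W l = V m;
  tiling_symmetric : forall V W, tau V -> tau W ->
    forall l, neighbour V l W ->
      forall m, W m = central_symmetry (midpoint V l) (V m)
}.

Definition tangent_part u v : plane R := (dot v u / dot u u) *: u.

Definition normal_part u v : plane R := v - tangent_part u v.

(* Snell's law with coefficient -1, at an edge with direction vector [u]. *)
Definition refract u v : plane R := normal_part u v - tangent_part u v.

(* [p n] is the n-th crossing point, on a side labelled [w n], where the
   trajectory leaves the tile [V n] with direction [d n] and enters the tile
   [V n.+1] with direction [d n.+1]. *)
Record trajectory (tau : set (tile R)) (V : nat -> tile R)
    (p d : nat -> plane R) (w : nat -> label) : Prop := {
  trajectory_tile : forall n, tau (V n);
  trajectory_crossing : forall n, open_side (V n) (w n) (p n);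
  trajectory_neighbour : forall n, neighbour (V n) (w n) (V n.+1);
  trajectory_refract : forall n,
    d n.+1 = refract (side_vector (V n) (w n)) (d n);
  trajectory_straight : forall n,
    exists2 t : R, 0 < t & p n.+1 = p n + t *: d n.+1;
  trajectory_inside : forall n (t : R), 0 < t < 1 ->
    open_triangle (V n.+1) ((1 - t) *: p n + t *: p n.+1)
}.

(* The trajectory is the polygonal curve with successive vertices [p n], so it
   closes up after [N] crossings when [p] is [N]-periodic. *)
Definition closes_up (p : nat -> plane R) (N : nat) : Prop :=
  (0 < N)%N /\ forall n, p (n + N)%N = p n.

Definition period (p : nat -> plane R) (N : nat) : Prop :=
  closes_up p N /\ forall M, closes_up p M -> (N <= M)%N.

End Geometry.

(* The infinite word uuu... for a nonempty finite word [u]. *)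
Definition periodic_word (u : seq label) (n : nat) : label :=
  nth 0 u (n %% size u).

Definition smallest_period (w : nat -> label) (s : seq label) : Prop :=
  [/\ (0 < size s)%N, w =1 periodic_word s &
      forall u, (0 < size u)%N -> w =1 periodic_word u ->
        (size s <= size u)%N].

(* Main.v *)
(* Fold the plane along the edges crossed by the trajectory.  Since neighbouring
   tiles are centrally symmetric and the refraction coefficient is -1, all folded
   tiles are inscribed in one circle and the folded trajectory stays on one line,
   hence on one chord.  Turning the tiles back to a fixed triangle with vertices
   [T l] instead, the forward end [x n] of the chord moves on the circumcircle: the
   side [l] is crossed when [x n] lies in the open arc [(T (l + 1), T (l - 1))],
   and [x n.+1] is then the image of [x n] under an orientation-reversing isometry
   that flips this arc, up to a rotation independent of [l].

   The circumcentres show that a trajectory which closes up after [N] crossings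
   has [N] even and each label occurring as often at even as at odd times, by affine
   independence of the vertices.  So the sum of [(-1)^j] over the points [x j] met
   when running along the circle from a vertex defines a step function on the circle
   that vanishes at all three vertices; it is invariant under the dynamics, up to a
   constant which periodicity kills.  Its mean value at [x n] is therefore the same
   for all [n], i.e. even and odd points alternate.  On one of the two values taken by
   the step function there is no vertex, so the components of this level set are permuted
   by the flips, and the two ends [x i] and [x k] of a component have the same future
   labels although [i] and [k] have opposite parities: the code has an odd period,
   hence its smallest period [m] is odd.  Conversely a code of odd period [m] makes the
   trajectory close up after [2m] crossings, so [N = 2m]; and [m = 1] is impossible
   because consecutive labels differ. *)

Require Import Defs.
From mathcomp Require Import all_boot all_order all_algebra.
From mathcomp Require Import all_classical all_reals.
From mathcomp Require Import complex zify ring lra.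

Set Implicit Arguments.
Unset Strict Implicit.
Unset Printing Implicit Defensive.

Import Order.TTheory GRing.Theory Num.Theory.
Local Open Scope ring_scope.

(** * Labels and periodic words *)

Lemma label_add2 (l : label) : l + 1 + 1 = l - 1.
Proof. by case: l => [[|[|[|//]]] i]; apply/val_inj. Qed.

Lemma label_sub2 (l : label) : l - 1 - 1 = l + 1.
Proof. by case: l => [[|[|[|//]]] i]; apply/val_inj. Qed.

Lemma label_cases (l m : label) : [\/ m = l, m = l + 1 | m = l - 1].
Proof.
case: l m => [[|[|[|//]]] i] [[|[|[|//]]] j];
  solve [ by apply: Or31; apply/val_inj | by apply: Or32; apply/val_inj
        | by apply: Or33; apply/val_inj ].
Qed.

Lemma sum_label (M : zmodType) (f : label -> M) l :
  \sum_i f i = f l + f (l + 1) + f (l - 1).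
Proof.
rewrite (bigD1 l) //= (bigD1 (l + 1)) /=; last by case: l => [[|[|[|//]]] i].
rewrite (big_pred1 (l - 1)) ?addrA // => i.
by case: l i => [[|[|[|//]]] ?] [[|[|[|//]]] ?].
Qed.

Section PeriodicSequences.
Variable A : Type.
Implicit Types f : nat -> A.

Lemma period_mul f m : (forall n, f (n + m)%N = f n) ->
  forall k n, f (n + k * m)%N = f n.
Proof. by move=> fm; elim=> [|k IH] n; rewrite ?addn0 // mulSn addnCA addnC fm. Qed.

(** Adding a multiple of [N] moves any index past [i], where the two tails agree. *)
Lemma period_tail f N i k : (0 < N)%N -> (forall n, f (n + N)%N = f n) ->
  (i <= k)%N -> (forall n, f (k + n)%N = f (i + n)%N) ->
  forall n, f (n + (k - i))%N = f n.
Proof.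
move=> N_gt0 fN ik fik n.
have le_i : (i <= n + i * N)%N by rewrite (leq_trans (leq_pmulr i N_gt0)) ?leq_addl.
rewrite -(period_mul fN i) -[RHS](period_mul fN i) -[in RHS](subnKC le_i) -fik.
by congr f; lia.
Qed.

Lemma minimal_period f N : (0 < N)%N -> (forall n, f (n + N)%N = f n) ->
  exists m, [/\ (0 < m)%N, forall n, f (n + m)%N = f n &
    forall k, (forall n, f (n + k)%N = f n) -> (m %| k)%N].
Proof.
move=> N_gt0 fN; pose Q k := (0 < k)%N && `[< forall n, f (n + k)%N = f n >].
have exQ : exists k, Q k by exists N; rewrite /Q N_gt0; apply/asboolP.
case: (ex_minnP exQ) => m /andP[m_gt0 /asboolP fm] m_min.
exists m; split=> // k fk; rewrite /dvdn -leqn0 leqNgt; apply/negP => r_gt0.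
have := m_min (k %% m)%N; rewrite leqNgt ltn_mod m_gt0 => /(_ _)/negP; apply=> //.
rewrite /Q r_gt0; apply/asboolP => n.
by rewrite -[LHS](period_mul fm (k %/ m)%N) -addnA [(k %% m + _)%N]addnC -divn_eq fk.
Qed.

End PeriodicSequences.

Lemma sum_period (f : nat -> int) N r : (forall n, f (n + N)%N = f n) ->
  \sum_(j < r * N) f j = (\sum_(j < N) f j) *+ r.
Proof.
move=> fN; elim: r => [|r IH]; first by rewrite big_ord0.
rewrite mulSn addnC big_split_ord /= {}IH mulrSr; congr (_ + _).
by apply: eq_bigr => j _; rewrite addnC (period_mul fN).
Qed.

Definition balanced (w : nat -> label) (N : nat) : Prop :=
  forall l, \sum_(j < N) (-1) ^+ j *+ (w j == l) = 0 :> int.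

(** * Flipped exchanges of three arcs of a cyclic order *)

Section CyclicOrder.
Variables (P : eqType) (cyc : P -> P -> P -> bool).

Record cyclic_order : Prop := CyclicOrder {
  cycC : forall a b c, cyc a b c -> cyc b c a;
  cyc_asym : forall a b c, cyc a b c -> ~~ cyc a c b;
  cyc_trans : forall a b c d, cyc a b c -> cyc a c d -> cyc a b d;
  cyc_total : forall a b c, a != b -> b != c -> a != c -> cyc a b c || cyc a c b }.

Hypothesis hcyc : cyclic_order.

Let C := cycC hcyc.
Let A := cyc_asym hcyc.
Let Tr := cyc_trans hcyc.

Lemma cyc_neq a b c : cyc a b c -> [/\ a != b, b != c & a != c].
Proof.
have irr x y : cyc x x y = false by apply/negP => h; have := A h; rewrite (C h).
move=> h; split; apply/negP => /eqP E; move: h; rewrite E ?irr //.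
  by move/C; rewrite irr.
by move/C/C; rewrite irr.
Qed.

Lemma cyc_aab a b : cyc a a b = false.
Proof. by apply/negP => /cyc_neq[]; rewrite eqxx. Qed.

Lemma cyc_abb a b : cyc a b b = false.
Proof. by apply/negP => /cyc_neq[]; rewrite eqxx. Qed.

Lemma cyc_negb a b c : a != b -> b != c -> a != c -> cyc a c b = ~~ cyc a b c.
Proof.
move=> ab bc ac; have := cyc_total hcyc ab bc ac.
by have := @A a b c; case: (cyc a b c) => [/(_ isT)/negbTE|_].
Qed.

Lemma cyc_shift o a b c : cyc o a b -> cyc o b c -> cyc a b c.
Proof.
move=> oab obc; have oac := Tr oab obc.
exact: C (C (Tr (C obc) (C (C oab)))).
Qed.

(** Moving the cut of the circle from [o] to [o'] changes the comparison of [a] with [z] only by a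
    term in [a] and a term in [z]. *)
Lemma cyc_cocycle o o' a z : o != o' -> a != o -> a != o' -> z != o -> z != o' ->
  (cyc o a z + cyc o z o' = cyc o' a z + cyc o a o')%N.
Proof.
move=> oo' ao ao' zo zo'; have [->|az] := eqVneq a z.
  by rewrite !cyc_abb.
have o'o : o' != o by rewrite eq_sym.
have E1 : cyc o z a = ~~ cyc o a z by rewrite cyc_negb // eq_sym.
have E2 : cyc o o' a = ~~ cyc o a o' by rewrite cyc_negb // eq_sym.
have E3 : cyc o o' z = ~~ cyc o z o' by rewrite cyc_negb // eq_sym.
case p: (cyc o a z) E1; case r: (cyc o a o') E2; case s: (cyc o z o') E3 => /= h3 h2 h1.
- by rewrite (C (C (cyc_shift p s))).
- by rewrite (negbTE (A (C (cyc_shift r h3)))).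
- by rewrite (Tr p s) in r.
- by rewrite (cyc_shift h2 p).
- by rewrite (negbTE (A (C (C (cyc_shift h1 r))))).
- by rewrite (Tr h1 r) in s.
- by rewrite (C (cyc_shift s h2)).
- by rewrite (negbTE (A (cyc_shift h3 h1))).
Qed.

Section Arcs.
Variable T : label -> P.
Hypothesis hT : forall l, cyc (T l) (T (l + 1)) (T (l - 1)).

Definition arc l y := cyc (T (l + 1)) y (T (l - 1)).

Lemma arc_disjoint l y : arc l y -> ~~ arc (l + 1) y.
Proof.
rewrite /arc label_add2 addrK => h; apply/negP => h'.
by move: (A (C (C (hT l)))); rewrite (Tr (C (C h)) h').
Qed.

Lemma arc_uniq l m y : arc l y -> arc m y -> l = m.
Proof.
move=> hl hm; case: (label_cases l m) => [//|E|E].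
  by move: (arc_disjoint hl); rewrite -E hm.
by move: (arc_disjoint hm); rewrite E subrK hl.
Qed.

Lemma arc_vertex l m : ~~ arc l (T m).
Proof.
rewrite /arc; case: (label_cases l m) => ->; rewrite ?cyc_aab ?cyc_abb //.
by apply/negP => /C h; move: (A (hT l)); rewrite h.
Qed.

End Arcs.

Local Notation sgn n := ((-1) ^+ n : int).

(** * Alternating counts of the points of a periodic sequence of even period *)

Section Signed.
Variables (x : nat -> P) (N : nat).
Hypothesis N_gt0 : (0 < N)%N.
Hypothesis N_even : ~~ odd N.
Hypothesis xN : forall n, x (n + N)%N = x n.
Hypothesis x_inj : forall i j, (i < N)%N -> (j < N)%N -> x i = x j -> i = j.

Lemma sign_period n : sgn (n + N) = sgn n.
Proof. by rewrite exprD -(signr_odd _ N) (negbTE N_even) mulr1. Qed.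

Lemma sign_mod n : sgn (n %% N) = sgn n.
Proof. by rewrite {2}(divn_eq n N) addnC (period_mul sign_period). Qed.

Lemma sign_total : \sum_(j < N) sgn j = 0.
Proof.
rewrite -(odd_double_half N) (negbTE N_even) add0n.
elim: (N./2) => [|k IH]; first by rewrite big_ord0.
by rewrite doubleS !big_ord_recr /= IH add0r exprS mulN1r subrr.
Qed.

Lemma sum_shift (f : nat -> int) : (forall n, f (n + N)%N = f n) ->
  \sum_(j < N) f j.+1 = \sum_(j < N) f j.
Proof.
move=> fN; apply: (addrI (f 0%N)); transitivity (\sum_(j < N.+1) f j).
  by rewrite big_ord_recl.
by rewrite big_ord_recr /= -[X in f X](add0n N) fN addrC.
Qed.

Lemma point_mod n : x (n %% N) = x n.
Proof. by rewrite {2}(divn_eq n N) addnC (period_mul xN). Qed.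

Lemma sum_at n : \sum_(j < N) sgn j *+ (x j == x n) = sgn n.
Proof.
have ltN : (n %% N < N)%N by rewrite ltn_mod.
rewrite (bigD1 (Ordinal ltN)) //= point_mod eqxx big1 ?addr0 => [|j jn].
  by rewrite mulr1n sign_mod.
case: eqP => // E; case/eqP: jn; apply/val_inj/x_inj => //=.
by rewrite point_mod.
Qed.

Lemma sign_eq i j : x i = x j -> sgn i = sgn j.
Proof. by move=> E; rewrite -sum_at -[RHS]sum_at E. Qed.

(** The step function on the circle cut at [o]; a point equal to [z] is left out, so this is the
    limit at [z] from the side of [o]. *)
Definition signed_count o z : int := \sum_(j < N) sgn j *+ cyc o (x j) z.

(* The sum of the two one-sided limits of [signed_count o] at the point [x n],
   so that no factor 1/2 is needed. *)
Definition level o n : int := sgn n + signed_count o (x n) *+ 2.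

(** Every point other than [x n] comes either before or after it from [o], and all signs together
    cancel. *)
Lemma signed_count_sym o n : (forall j, x j != o) ->
  signed_count o (x n) + \sum_(j < N) sgn j *+ cyc o (x n) (x j) = - sgn n.
Proof.
move=> xo; have <- : \sum_(j < N) (sgn j - sgn j *+ (x j == x n)) = - sgn n.
  by rewrite sumrB sign_total sum_at add0r.
rewrite -big_split /=.
apply: eq_bigr => j _; have [->|nj] := eqVneq (x j) (x n).
  by rewrite !cyc_abb !mulr0n mulr1n addr0 subrr.
rewrite (@cyc_negb o (x j) (x n)) // 1?eq_sym // subr0 -mulrnDr.
by case: (cyc _ _ _).
Qed.

(** This is [cyc_cocycle] summed with signs; the term [cyc o (x n) o'] does not involve [j] and dies
    with [sign_total]. *)
Lemma level_change o o' n : (forall j, x j != o) -> (forall j, x j != o') ->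
  o != o' -> level o n - level o' n = signed_count o o' *+ 2.
Proof.
move=> xo xo' oo'; rewrite /level opprD addrACA subrr add0r -mulrnBl.
congr (_ *+ 2); apply/eqP; rewrite subr_eq addrC; apply/eqP.
have E : \sum_(j < N) sgn j *+ cyc o (x n) o' = 0.
  by rewrite sumrMnl sign_total mul0rn.
rewrite -[LHS]addr0 -[X in _ + X]E -!big_split /=.
by apply: eq_bigr => j _; rewrite -!mulrnDr cyc_cocycle.
Qed.

(** By [level_change], two vertices differ by the signed count of the arc between them, which
    collects the times of a single label. *)
Lemma level_vertex (T : label -> P) (v : nat -> label) :
  (forall l, cyc (T l) (T (l + 1)) (T (l - 1))) ->
  (forall n, arc T (v n) (x n)) -> balanced v N ->
  forall l m n, level (T l) n = level (T m) n.
Proof.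
move=> hT hv bal l m n.
have xT j k : x j != T k.
  by apply/negP => /eqP E; move: (hv j) (arc_vertex hT (v j) k); rewrite E => ->.
suff step k : level (T (k + 1)) n = level (T (k - 1)) n.
  case: (label_cases l m) => -> //.
    by move: (step (l - 1)); rewrite label_sub2 subrK.
  by move: (step (l + 1)); rewrite label_add2 addrK.
have /cyc_neq[_ Tk _] := hT k.
apply/eqP; rewrite -subr_eq0 level_change // /signed_count.
rewrite (eq_bigr (fun j : 'I_N => sgn j *+ (v j == k))) ?bal // => j _.
congr (_ *+ nat_of_bool _); apply/idP/eqP => [h|<-]; last exact: hv.
exact: arc_uniq (hv j) h.
Qed.

Lemma first_point o (Q : pred 'I_N) i0 : Q i0 ->
  exists2 i, Q i & forall j, Q j -> ~~ cyc o (x j) (x i).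
Proof.
move=> Qi0.
have [i Qi mini] := arg_minnP (fun i : 'I_N => #|[pred m | Q m & cyc o (x m) (x i)]|) Qi0.
exists i => // j Qj; apply/negP => oji.
have := mini j Qj; rewrite leqNgt => /negP; apply; apply/proper_card/properP.
split; first by apply/fintype.subsetP => m /andP[Qm omj]; apply/andP; split;
  rewrite ?(Tr omj oji).
by exists j; rewrite !inE Qj ?oji ?cyc_abb.
Qed.

Lemma signed_count_eq0 o z : (forall j, ~~ cyc o (x j) z) -> signed_count o z = 0.
Proof. by move=> h; apply: big1 => j _; rewrite (negbTE (h j)). Qed.

(** * The flipped exchange along an orbit of even period *)

Section FlippedExchange.
Variables (w : nat -> label) (T T' : label -> P) (rho : label -> P -> P).
Hypothesis w_balanced : balanced w N.
Hypothesis hT : forall l, cyc (T l) (T (l + 1)) (T (l - 1)).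
Hypothesis hT' : forall l, cyc (T' l) (T' (l + 1)) (T' (l - 1)).
Hypothesis x_arc : forall n, arc T (w n) (x n).
Hypothesis rho_flip : forall l a b c, cyc (rho l a) (rho l c) (rho l b) = cyc a b c.
Hypothesis rho_succ : forall l, rho l (T (l + 1)) = T' (l - 1).
Hypothesis rho_pred : forall l, rho l (T (l - 1)) = T' (l + 1).
Hypothesis x_step : forall n, x n.+1 = rho (w n) (x n).

Lemma label_period n : w (n + N) = w n.
Proof. by apply: (arc_uniq hT (x_arc _)); rewrite xN. Qed.

(* The label crossed just before time [n]; the shift by [N] makes [n = 0] sensible. *)
Definition pred_label n := w (n + N).-1.

Lemma pred_labelS n : pred_label n.+1 = w n.
Proof. by rewrite /pred_label addSn /= label_period. Qed.

Lemma next_point_arc n : arc T' (w n) (x n.+1).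
Proof. by rewrite /arc x_step -rho_succ -rho_pred; rewrite rho_flip;
  exact: C (C (x_arc n)). Qed.

Lemma pred_label_arc n : arc T' (pred_label n) (x n).
Proof. by have := next_point_arc (n + N).-1; rewrite prednK ?xN // addn_gt0 N_gt0 orbT. Qed.

Lemma pred_label_balanced : balanced pred_label N.
Proof.
move=> l; have sh := sum_shift (f := fun j => sgn j *+ (pred_label j == l)).
apply: etrans (esym (sh _)) _ => [n|/=]; last first.
  under eq_bigr => j _ do rewrite pred_labelS exprS mulN1r mulNrn.
  by rewrite sumrN w_balanced oppr0.
have E : (n + N + N).-1 = ((n + N).-1 + N)%N by case: (N) N_gt0 => // k _; rewrite !addnS.
by rewrite sign_period /pred_label E label_period.
Qed.

Lemma point_neq_vertex n l : x n != T l.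
Proof. by apply/negP => /eqP E; move: (x_arc n) (arc_vertex hT (w n) l); rewrite E => ->. Qed.

Lemma point_neq_image_vertex n l : x n != T' l.
Proof.
by apply/negP => /eqP E; move: (pred_label_arc n) (arc_vertex hT' (pred_label n) l);
  rewrite E => ->.
Qed.

Lemma level_vertexE l m n : level (T l) n = level (T m) n.
Proof. exact: level_vertex hT x_arc w_balanced l m n. Qed.

Lemma level_image_vertexE l m n : level (T' l) n = level (T' m) n.
Proof. exact: level_vertex hT' pred_label_arc pred_label_balanced l m n. Qed.

(** Either side forces [x j] into the arc of [x i], and the flip of this arc sends its final part,
    beyond [x i], to the initial part of the image arc. *)
Lemma between_succ i j : cyc (T' (w i + 1)) (x j.+1) (x i.+1) =
  cyc (T (w i - 1)) (x i) (x j).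
Proof.
apply/idP/idP => h.
  have : arc T' (w i) (x j.+1) by apply: Tr h (next_point_arc i).
  move/(arc_uniq hT' (next_point_arc j)) => E.
  by move: h; rewrite !x_step E -rho_pred rho_flip.
have wj : w j = w i.
  exact: (arc_uniq hT (x_arc j)) (C (Tr (C (C (x_arc i))) h)).
by rewrite !x_step wj -rho_pred rho_flip.
Qed.

(** With base points at the arc ends matched by the flip, points before [x n.+1] come from points
    after [x n] with opposite sign; [signed_count_sym] trades after for before. *)
Lemma level_succ n : level (T' 0) n.+1 = level (T 0) n.
Proof.
rewrite (level_image_vertexE _ (w n + 1)) (level_vertexE _ (w n - 1)) /level.
have -> : signed_count (T' (w n + 1)) (x n.+1) =
    - \sum_(j < N) sgn j *+ cyc (T (w n - 1)) (x n) (x j).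
  have sh := sum_shift (f := fun j => sgn j *+ cyc (T' (w n + 1)) (x j) (x n.+1)).
  apply: etrans (esym (sh _)) _ => [j|/=]; first by rewrite sign_period xN.
  under eq_bigr => j _ do rewrite between_succ exprS mulN1r mulNrn.
  by rewrite sumrN.
have /(canRL (addrK _)) -> := signed_count_sym n (point_neq_vertex^~ (w n - 1)).
by rewrite exprS; ring.
Qed.

(** The bases [T 0] and [T' 0] give levels differing by a constant [k], so each step adds [k], and
    after [N] steps [k *+ N = 0]. *)
Lemma level_const n : level (T 0) n = level (T 0) 0.
Proof.
have [k hk] : exists k, forall n, level (T 0) n = level (T' 0) n + k.
  have [<-|neq] := eqVneq (T 0) (T' 0); first by exists 0 => m; rewrite addr0.
  exists (signed_count (T 0) (T' 0) *+ 2) => m.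
  by rewrite -(level_change m (point_neq_vertex^~ 0) (point_neq_image_vertex^~ 0) neq) addrC
    subrK.
have lin m : level (T 0) m = level (T 0) 0 + k *+ m.
  by elim: m => [|m IH]; rewrite ?addr0 // hk level_succ IH mulrSr addrA.
suff k0 : k = 0 by rewrite lin k0 mul0rn addr0.
have levN : level (T 0) N = level (T 0) 0 by rewrite /level -(sign_period 0) -(xN 0) add0n.
have /eqP := lin N; rewrite levN -[X in X == _]addr0 (inj_eq (addrI _)) eq_sym mulrn_eq0.
by case: (N) N_gt0 => //= ? _ /eqP.
Qed.

(* [x i] and [x k] are the two ends, in this order, of a component of the level
   set of [signed_count (T 0)] that contains no vertex. *)
Definition adjacent i k := [/\ sgn i = level (T 0) 0, sgn k = - level (T 0) 0 &
  forall j, ~~ cyc (x i) (x j) (x k)].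

Lemma sign_neqN n : sgn n != - sgn n.
Proof. by rewrite -signr_odd; case: (odd n). Qed.

Lemma adjacent_neq i k : adjacent i k -> x i != x k.
Proof.
by case=> si sk _; apply/negP => /eqP /sign_eq E; move: (sign_neqN k);
  rewrite {2}sk opprK -si E eqxx.
Qed.

(** Seen from a vertex in the gap, no point would precede [x k], so its level would be [sgn k], not
    the opposite. *)
Lemma interval_free i k m : sgn k = - level (T 0) 0 ->
  (forall j, ~~ cyc (x i) (x j) (x k)) -> ~~ cyc (x i) (T m) (x k).
Proof.
move=> sk ik; apply/negP => h; have := level_const k.
rewrite (level_vertexE 0 m) {1}/level signed_count_eq0 => [|j]; last first.
  by apply/negP => h'; move: (ik j); rewrite (C (Tr (C (C h)) (C (C h')))).
by move=> E; move: (sign_neqN k); rewrite {2}sk -E mul0rn addr0 opprK eqxx.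
Qed.

Lemma adjacent_order i k : adjacent i k -> cyc (x i) (x k) (T (w i - 1)).
Proof.
move=> ik; have [_ sk free] := ik.
by rewrite (@cyc_negb (x i) (T (w i - 1))) ?interval_free ?adjacent_neq ?point_neq_vertex //
  eq_sym point_neq_vertex.
Qed.

Lemma adjacent_label i k : adjacent i k -> w k = w i.
Proof.
move=> /adjacent_order ik; apply: (arc_uniq hT (x_arc k)).
exact: C (Tr (C (C (x_arc i))) (C (C ik))).
Qed.

(** Both ends lie in one arc, so a single flip carries the gap onto the next one: it swaps the order
    of the ends while both signs change. *)
Lemma adjacent_succ i k : adjacent i k -> adjacent k.+1 i.+1.
Proof.
move=> ik; have [si sk free] := ik; have wk := adjacent_label ik.
split=> [||j]; rewrite ?exprS ?mulN1r ?si ?sk ?opprK //.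
(* The shift by [N] presents [x j] as an image point even when [j = 0]. *)
apply/negP; rewrite -(xN j) -[(j + N)%N]prednK ?addn_gt0 ?N_gt0 ?orbT //.
set j' := (j + N).-1 => h.
have ord : cyc (T' (w i + 1)) (x k.+1) (x i.+1).
  rewrite -rho_pred !x_step wk rho_flip; apply/C/C/adjacent_order; exact: ik.
have arc' : arc T' (w i) (x j'.+1).
  exact: Tr (C (C (cyc_shift h (C ord)))) (next_point_arc i).
have wj := arc_uniq hT' (next_point_arc j') arc'.
by move: h; rewrite !x_step wk wj rho_flip => /C h; move: (free j'); rewrite h.
Qed.

(** The first two points met from [T 0] will do: their levels are [sgn i] and [sgn k + sgn i *+ 2],
    and these are equal. *)
Lemma adjacent_exists : exists i k, adjacent i k.
Proof.
have [i _ hi] := @first_point (T 0) predT (Ordinal N_gt0) isT.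
have si : sgn i = level (T 0) 0.
  rewrite -(level_const i) /level signed_count_eq0 ?mul0rn ?addr0 // => j.
  by rewrite -point_mod; apply: (hi (Ordinal (ltn_pmod j N_gt0))).
(* A second index exists because a single sign cannot sum to zero. *)
have [k0 k0i] : exists k0, k0 != i.
  case: (pickP (fun k => k != i)) => [k ki|all_i]; first by exists k.
  have := sign_total; rewrite (bigD1 i) //= big_pred0 ?addr0 // => /eqP.
  by rewrite signr_eq0.
have [k ki hk] := @first_point (T 0) (fun k => k != i) k0 k0i.
have xki : x k != x i.
  by apply: contra ki => /eqP E; exact/eqP/val_inj/(x_inj (ltn_ord k) (ltn_ord i)).
have Tik : cyc (T 0) (x i) (x k).
  by rewrite (@cyc_negb (T 0) (x k)) ?hi // eq_sym point_neq_vertex.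
have sk : sgn k = - level (T 0) 0.
  have := level_const k; rewrite {1}/level /signed_count (bigD1 i) //= Tik mulr1n.
  rewrite big1 ?addr0 => [|j ji]; last by rewrite (negbTE (hk _ ji)).
  by rewrite si mulr2n => /(canRL (addrK _)) ->; rewrite opprD addrA subrr add0r.
exists i, k; split=> // j; apply/negP => h.
have Tjk : cyc (T 0) (x j) (x k) := C (C (cyc_shift h (C Tik))).
have [E|ne] := eqVneq (x j) (x i); first by rewrite E cyc_aab in h.
have := hk (Ordinal (ltn_pmod j N_gt0)); rewrite /= point_mod Tjk; move/(_ _)/negP; apply=> //.
by apply: contra ne => /eqP <- /=; rewrite point_mod.
Qed.

Lemma flipped_exchange_odd_period :
  exists2 j, odd j & forall n, w (n + j)%N = w n.
Proof.
have [i [k ik]] := adjacent_exists.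
have wik n : w (k + n)%N = w (i + n)%N.
  have [/adjacent_label //|/adjacent_label //] :
      adjacent (i + n) (k + n) \/ adjacent (k + n) (i + n).
  elim: n => [|n [] /adjacent_succ]; rewrite ?addnS; [|by right|by left].
  by left; rewrite !addn0.
have odd_ik : odd i != odd k.
  have [si sk _] := ik; apply/negP => /eqP E; move: (sign_neqN i).
  by rewrite {2}si -sk -signr_odd E signr_odd eqxx.
wlog lt_ik : i k wik odd_ik {ik} / (i < k)%N => [IH|].
  case: (ltngtP i k) => [|lt|E]; first exact: IH.
    by apply: (IH k i) => //; rewrite eq_sym.
  by rewrite E eqxx in odd_ik.
exists (k - i)%N; first by rewrite oddB 1?ltnW //; move: odd_ik; case: (odd i); case: (odd k).
exact: (period_tail N_gt0 label_period (ltnW lt_ik)).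
Qed.

End FlippedExchange.
End Signed.

(** The least period [m] of [x] is either odd, hence as wanted, or even; then [x] is injective over
    it, and balance passes from [N] to [m] because the sum over [N] is a multiple of that over
    [m]. *)
Lemma balanced_exchange_odd_period (x : nat -> P) (N : nat) (w : nat -> label)
    (T T' : label -> P) (rho : label -> P -> P) :
  (0 < N)%N -> (forall n, x (n + N)%N = x n) -> balanced w N ->
  (forall l, cyc (T l) (T (l + 1)) (T (l - 1))) ->
  (forall l, cyc (T' l) (T' (l + 1)) (T' (l - 1))) ->
  (forall n, arc T (w n) (x n)) ->
  (forall l a b c, cyc (rho l a) (rho l c) (rho l b) = cyc a b c) ->
  (forall l, rho l (T (l + 1)) = T' (l - 1)) ->
  (forall l, rho l (T (l - 1)) = T' (l + 1)) ->
  (forall n, x n.+1 = rho (w n) (x n)) ->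
  exists2 j, odd j & forall n, w (n + j)%N = w n.
Proof.
move=> N_gt0 xN bal hT hT' x_arc rho_flip rho_succ rho_pred x_step.
have w_eq i j : x i = x j -> w i = w j.
  by move=> E; apply: (arc_uniq hT (x_arc i)); rewrite E.
have [m [m_gt0 xm m_min]] := minimal_period N_gt0 xN.
have [odd_m|even_m] := boolP (odd m).
  by exists m => // n; apply: w_eq.
have x_tail i j n : x i = x j -> x (i + n)%N = x (j + n)%N.
  by move=> E; elim: n => [|n IH]; rewrite ?addn0 // !addnS !x_step IH (w_eq _ _ IH).
have x_lt i j : (j < m)%N -> (i < j)%N -> x i <> x j.
  move=> jm ij /x_tail E.
  have := m_min _ (period_tail m_gt0 xm (ltnW ij) (fun n => esym (E n))).
  by move/dvdn_leq; rewrite subn_gt0 => /(_ ij);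
    rewrite leqNgt (leq_ltn_trans (leq_subr _ _) jm).
have x_inj i j : (i < m)%N -> (j < m)%N -> x i = x j -> i = j.
  move=> im jm E; case: (ltngtP i j) => // lt; first by case: (x_lt _ _ jm lt).
  by case: (x_lt _ _ im lt).
have bal_m : balanced w m.
  move=> l; have := bal l; rewrite -(divnK (m_min _ xN)).
  rewrite (@sum_period (fun j => sgn j *+ (w j == l))) => [/eqP|n].
    rewrite mulrn_eq0 => /orP[|/eqP //].
    by rewrite -leqn0 leqNgt divn_gt0 // dvdn_leq // m_min.
  by rewrite sign_period // (w_eq _ _ (xm n)).
exact: (flipped_exchange_odd_period m_gt0 even_m xm x_inj bal_m hT hT' x_arc
  rho_flip rho_succ rho_pred x_step).
Qed.

End CyclicOrder.

(** * Chords of a circle *)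

Section Circle.
Variable R : rcfType.
Implicit Types a b c z : R[i].
Local Notation "z ^*" := (conjc z) : ring_scope.
Local Notation Re := complex.Re.
Local Notation Im := complex.Im.

Lemma conjcD a b : (a + b : R[i])^* = a^* + b^*.
Proof. by case: a b => [? ?] [? ?]; simpc. Qed.

Lemma conjcN a : (- a : R[i])^* = - a^*.
Proof. by case: a. Qed.

Lemma conjcB a b : (a - b : R[i])^* = a^* - b^*.
Proof. by rewrite conjcD conjcN. Qed.

Lemma conjcM a b : (a * b : R[i])^* = a^* * b^*.
Proof. by case: a b => [? ?] [? ?]; simpc. Qed.

Definition cross a b : R := Re a * Im b - Im a * Re b.

Definition orient a b c := cross (b - a) (c - a).

Lemma crossC a b : cross b a = - cross a b.
Proof. by rewrite /cross; ring. Qed.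

Lemma crossDr a b c : cross a (b + c) = cross a b + cross a c.
Proof. by case: a b c => [? ?] [? ?] [? ?]; rewrite /cross /=; ring. Qed.

Lemma crossDl a b c : cross (b + c) a = cross b a + cross c a.
Proof. by case: a b c => [? ?] [? ?] [? ?]; rewrite /cross /=; ring. Qed.

Lemma crossZr k a b : cross a (k%:C%C * b) = k * cross a b.
Proof. by case: a b => [? ?] [? ?]; rewrite /cross /=; ring. Qed.

Lemma crossZl k a b : cross (k%:C%C * a) b = k * cross a b.
Proof. by case: a b => [? ?] [? ?]; rewrite /cross /=; ring. Qed.

Lemma crossN a b : cross (- a) b = - cross a b.
Proof. by case: a b => [? ?] [? ?]; rewrite /cross /=; ring. Qed.

Lemma crossNr a b : cross b (- a) = - cross b a.
Proof. by rewrite crossC crossN -crossC. Qed.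

Lemma cross_conj a b : cross a^* b^* = - cross a b.
Proof. by case: a b => [? ?] [? ?]; rewrite /cross /=; ring. Qed.

Lemma crossM z a b : cross (z * a) (z * b) = Re (z * z^*) * cross a b.
Proof. by case: z a b => [? ?] [? ?] [? ?]; rewrite /cross /=; ring. Qed.

Lemma cross_eq0 a b : cross a b = 0 -> a^* * b = a * b^*.
Proof.
by case: a b => [a0 a1] [b0 b1]; rewrite /cross /= => h; apply/eqP; simpc;
  rewrite eq_complex /=; apply/andP; split; apply/eqP; lra.
Qed.

Lemma orientC a b c : orient b c a = orient a b c.
Proof. by case: a b c => [? ?] [? ?] [? ?]; rewrite /orient /cross /=; ring. Qed.

Lemma orient_swap a b c : orient a c b = - orient a b c.
Proof. exact: crossC. Qed.

Lemma orient_translate o a b c : orient (a - o) (b - o) (c - o) = orient a b c.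
Proof. by case: o a b c => [? ?] [? ?] [? ?] [? ?]; rewrite /orient /cross /=; ring. Qed.

Variables (rho s : R).
Hypothesis rho_gt0 : 0 < rho.
Hypothesis s_neq0 : s != 0.

Definition on_circle z := z * z^* == rho%:C%C.

Definition circle := {z | on_circle z}.

(** The factor [s] will be the orientation of the triangle, so that its vertices are in cyclic order
    whichever way it is labelled. *)
Definition ccyc (a b c : circle) : bool := 0 < s * orient (val a) (val b) (val c).

Lemma on_circle_neq0 z : on_circle z -> z != 0.
Proof. by apply: contraTneq => ->; rewrite /on_circle mul0r eq_sym (inj_eq (@complexI R))
  gt_eqF. Qed.

Lemma on_circle_conj z : on_circle z -> z^* = rho%:C%C / z.
Proof. by move=> hz; rewrite -(eqP hz) mulrAC mulfV ?mul1r // on_circle_neq0. Qed.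

Lemma on_circleE z : on_circle z -> Re z ^+ 2 + Im z ^+ 2 = rho.
Proof. by case: z => x y; rewrite /on_circle; simpc;
  rewrite eq_complex /= => /andP[/eqP <- _]; ring. Qed.

(** On the circle the conjugate of [z] is [rho / z], which turns collinearity into the vanishing of
    a product of differences. *)
Lemma orient_neq0 a b c : on_circle a -> on_circle b -> on_circle c ->
  a != b -> b != c -> a != c -> orient a b c != 0.
Proof.
move=> ha hb hc ab bc ac; apply/eqP => /cross_eq0 /eqP.
have [a0 b0 c0] := And3 (on_circle_neq0 ha) (on_circle_neq0 hb) (on_circle_neq0 hc).
rewrite !conjcB !on_circle_conj // -subr_eq0.
have -> : (rho%:C%C / b - rho%:C%C / a) * (c - a) - (b - a) * (rho%:C%C / c - rho%:C%C / a)
   = rho%:C%C * (a - b) * (c - a) * (c - b) / (a * b * c) by field; rewrite a0 b0 c0.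
rewrite !mulf_eq0 invr_eq0 !mulf_eq0 (negbTE a0) (negbTE b0) (negbTE c0) !orbF.
by rewrite (inj_eq (@complexI R) _ 0) gt_eqF //= !subr_eq0 (negbTE ab) eq_sym (negbTE ac)
  eq_sym (negbTE bc).
Qed.

(** Inversion at [a] opens the circle into a line, where the order is linear. *)
Lemma orient_trans a b c d : on_circle a -> on_circle b -> on_circle c -> on_circle d ->
  0 < s * orient a b c -> 0 < s * orient a c d -> 0 < s * orient a b d.
Proof.
move=> /on_circleE ha /on_circleE hb /on_circleE hc /on_circleE hd.
case: a b c d ha hb hc hd => [a0 a1] [b0 b1] [c0 c1] [d0 d1];
  rewrite /orient /cross /= => ha hb hc hd.
pose n x0 x1 := rho - (a0 * x0 + a1 * x1).
have ng x0 x1 : x0 ^+ 2 + x1 ^+ 2 = rho -> n x0 x1 = ((x0 - a0) ^+ 2 + (x1 - a1) ^+ 2) / 2.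
  by move=> hx; rewrite /n; nra.
set X := s * _ => hX; set Y := s * _ => hY; set Z := s * _.
(* On the circle [n] is half the squared distance from [a]; this is additivity of differences on the
   inverted line, with denominators cleared. *)
have key : n c0 c1 * Z = n b0 b1 * Y + n d0 d1 * X.
  by rewrite /X /Y /Z /n -ha; ring.
have pos x0 x1 u v : x0 ^+ 2 + x1 ^+ 2 = rho ->
    0 < s * ((x0 - a0) * u - (x1 - a1) * v) -> 0 < n x0 x1.
  move=> hx h; rewrite ng // divr_gt0 // lt0r addr_ge0 ?sqr_ge0 // andbT.
  rewrite paddr_eq0 ?sqr_ge0 // !sqrf_eq0; apply: contraTN h => /andP[/eqP -> /eqP ->].
  by rewrite !mul0r subrr mulr0 ltxx.
have b_pos : 0 < n b0 b1 by apply: pos hX.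
have c_pos : 0 < n c0 c1 by apply: pos hY.
have d_pos : 0 < n d0 d1.
  by apply: (pos _ _ (- (c1 - a1)) (- (c0 - a0))) => //; rewrite (_ : _ * _ = Y) // /Y; ring.
by rewrite -(pmulr_rgt0 Z c_pos) key; apply: addr_gt0; apply: mulr_gt0.
Qed.

Lemma circle_cyclic_order : cyclic_order ccyc.
Proof.
split; rewrite /ccyc.
- by move=> a b c; rewrite (orientC (val a) (val b)).
- by move=> a b c; rewrite (orient_swap _ (val b)) mulrN oppr_gt0 -leNgt => /ltW.
- by move=> [a ha] [b hb] [c hc] [d hd]; apply: orient_trans.
move=> a b c ab bc ac; rewrite (orient_swap _ (val b)) mulrN oppr_gt0 -neq_lt eq_sym
  mulf_neq0 //.
by rewrite orient_neq0 ?(valP a) ?(valP b) ?(valP c) ?(inj_eq val_inj).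
Qed.

Lemma on_circle_reflect u z : u * u^* = 1 -> on_circle z -> on_circle (u * z^*).
Proof.
move=> hu hz; rewrite /on_circle conjcM conjcK mulrACA hu mul1r mulrC; exact: hz.
Qed.

Lemma orient_reflect u a b c : u * u^* = 1 ->
  orient (u * a^*) (u * b^*) (u * c^*) = - orient a b c.
Proof.
by move=> hu; rewrite /orient -!mulrBr -!conjcB crossM hu mul1r cross_conj.
Qed.

Lemma orient_rotate u a b c : u * u^* = 1 ->
  orient (u * a) (u * b) (u * c) = orient a b c.
Proof. by move=> hu; rewrite /orient -!mulrBr crossM hu mul1r. Qed.

Lemma on_circle_rotate u z : u * u^* = 1 -> on_circle z -> on_circle (u * z).
Proof. by move=> hu hz; rewrite /on_circle conjcM mulrACA hu mul1r; exact: hz. Qed.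

Section FoldedTrajectory.
Variables (T : label -> R[i]) (w : nat -> label) (e q : nat -> R[i]).
Hypothesis T_circle : forall l, on_circle (T l).
Hypothesis T_orient : forall l, orient (T l) (T (l + 1)) (T (l - 1)) = s.

(* [z |-> axis l * z^*] is the reflection in the perpendicular bisector of the
   side [l]. *)
Definition axis l : R[i] := T (l + 1) * T (l - 1) / rho%:C%C.

(* [e n] and [q n] are the direction and the exit point of the trajectory in the
   n-th tile, moved back to the triangle [T] centred at its circumcentre. *)
Hypothesis e_step : forall n, e n.+1 = - (axis (w n) * (e n)^*).
Hypothesis q_side : forall n, exists2 k : R, 0 < k < 1 &
  q n = k%:C%C * T (w n + 1) + (1 - k)%:C%C * T (w n - 1).
Hypothesis q_step : forall n, exists t : R,
  q n.+1 = axis (w n) * (q n)^* + t%:C%C * e n.+1.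
Hypothesis outward : forall n, 0 < s * cross (e n) (T (w n - 1) - T (w n + 1)).

Let T0 l : T l != 0 := on_circle_neq0 (T_circle l).

Let rho0 : rho%:C%C != 0 :> R[i].
Proof. by rewrite (inj_eq (@complexI R) _ 0) gt_eqF. Qed.

Lemma axis_unit l : axis l * (axis l)^* = 1.
Proof.
rewrite /axis !conjcM conjc_inv conjc_real !(on_circle_conj (T_circle _)).
by field; rewrite rho0 !T0.
Qed.

Lemma axis_succ l : axis l * (T (l + 1))^* = T (l - 1).
Proof. by rewrite /axis (on_circle_conj (T_circle _)); field; rewrite rho0 T0. Qed.

Lemma axis_pred l : axis l * (T (l - 1))^* = T (l + 1).
Proof. by rewrite /axis (on_circle_conj (T_circle _)); field; rewrite rho0 T0. Qed.

Lemma e_neq0 n : e n != 0.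
Proof.
by apply: contraTneq (outward n) => ->; rewrite /cross !mul0r subrr mulr0 ltxx.
Qed.

Definition speed : R := Re (e 0%N * (e 0%N)^*).

Lemma e_norm n : e n * (e n)^* = speed%:C%C.
Proof.
elim: n => [|n IH].
  by rewrite /speed; case: (e _) => x y; simpc; rewrite /=; congr Complex; ring.
rewrite e_step conjcN mulrNN conjcM conjcK mulrACA axis_unit mul1r mulrC; exact: IH.
Qed.

Lemma speed_gt0 : 0 < speed.
Proof.
have := e_neq0 0%N; rewrite /speed; case: (e _) => x y; rewrite eq_complex /= negb_and => h.
have -> : x * x - y * - y = x ^+ 2 + y ^+ 2 by ring.
by rewrite lt0r paddr_eq0 ?sqr_ge0 // !sqrf_eq0 negb_and h addr_ge0 ?sqr_ge0.
Qed.

Definition moment : R := cross (e 0%N) (q 0%N).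

(** The reflection negates [cross], the minus sign in [e_step] restores it, and moving along
    [e n.+1] changes nothing. *)
Lemma momentE n : cross (e n) (q n) = moment.
Proof.
elim: n => // n <-; have [t ->] := q_step n.
rewrite crossDr crossZr [cross (e _) (e _)](_ : _ = 0) ?mulr0 ?addr0.
  by rewrite e_step crossN crossM axis_unit mul1r cross_conj opprK.
by rewrite /cross mulrC subrr.
Qed.

Lemma q_inside n : Re (q n * (q n)^*) < rho.
Proof.
have [k /andP[k0 k1] ->] := q_side n; set l := w n.
have : T (l + 1) != T (l - 1).
  have := s_neq0; rewrite -(T_orient l) -(orientC (T l)); apply: contraNneq => ->.
  by rewrite /orient subrr /cross !mul0r subrr.
have /on_circleE := T_circle (l + 1); have /on_circleE := T_circle (l - 1).
case: (T (l + 1)) => a0 a1; case: (T (l - 1)) => b0 b1 /=; rewrite eq_complex /= => hb ha ab.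
have d : 0 < (a0 - b0) ^+ 2 + (a1 - b1) ^+ 2.
  rewrite lt0r paddr_eq0 ?sqr_ge0 // !sqrf_eq0 !subr_eq0 ab addr_ge0 ?sqr_ge0 //.
rewrite -subr_gt0; rewrite [X in 0 < X](_ : _ = k * (1 - k) * ((a0 - b0) ^+ 2 + (a1 - b1) ^+
  2)).
  by rewrite !mulr_gt0 // subr_gt0.
have -> : rho = k * (a0 ^+ 2 + a1 ^+ 2) + (1 - k) * (b0 ^+ 2 + b1 ^+ 2) by rewrite ha hb; ring.
by simpc; rewrite /=; ring.
Qed.

(* Multiplication by [chord] sends a direction of the trajectory to the forward
   end of the chord that it spans: the chords of all [e n] are at the same signed
   distance from the centre because of [momentE]. *)
Definition chord : R[i] := (Num.sqrt (rho * speed - moment ^+ 2) / speed +i* (moment /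
  speed))%C.

Let g n := Re ((e n)^* * q n).

Lemma e_normE n : Re (e n) ^+ 2 + Im (e n) ^+ 2 = speed.
Proof.
have := e_norm n; case: (e n) => x y; simpc => /eqP; rewrite eq_complex /= => /andP[/eqP <- _].
by ring.
Qed.

Let lagrange n : g n ^+ 2 + moment ^+ 2 = speed * Re (q n * (q n)^*).
Proof.
rewrite -(momentE n) -(e_normE n) /g /cross; case: (e n) (q n) => [x y] [z t]; simpc;
  rewrite /=.
by ring.
Qed.

(** By Lagrange's identity this says that the exit point is inside the circle. *)
Lemma half_chord_gt n : g n ^+ 2 < rho * speed - moment ^+ 2.
Proof. by rewrite ltrBrDr lagrange mulrC ltr_pM2r ?speed_gt0 ?q_inside. Qed.

Lemma chord_norm : chord * chord^* = (rho / speed)%:C%C.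
Proof.
rewrite /chord; simpc; congr Complex; last by ring.
have := sqr_sqrtr (ltW (le_lt_trans (sqr_ge0 _) (half_chord_gt 0))).
set r := Num.sqrt _ => hr.
have sp0 := lt0r_neq0 speed_gt0.
have -> : r / speed * (r / speed) + moment / speed * (moment / speed) =
  (r ^+ 2 + moment ^+ 2) / speed ^+ 2 by field.
by rewrite hr subrK; field.
Qed.

Lemma chord_circle n : on_circle (chord * e n).
Proof.
rewrite /on_circle conjcM mulrACA chord_norm e_norm -rmorphM divfK //.
exact: lt0r_neq0 speed_gt0.
Qed.

(** The inner products of [e n] with the end of the chord and with the exit point are [r] and
    [g n]. *)
Lemma chord_forward n : exists2 t : R, 0 < t & chord * e n = q n + t%:C%C * e n.
Proof.
have sp := speed_gt0; have sp0 := lt0r_neq0 sp.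
set r := Num.sqrt (rho * speed - moment ^+ 2).
have g_lt : g n < r.
  apply: le_lt_trans (ler_norm _) _; rewrite -sqrtr_sqr ltr_sqrt ?half_chord_gt //.
  exact: le_lt_trans (sqr_ge0 _) (half_chord_gt n).
exists ((r - g n) / speed); first by rewrite divr_gt0 // subr_gt0.
have E := e_normE n; rewrite /chord -/r -(momentE n) /g /cross.
move: sp0; rewrite -E {E}; case: (e n) (q n) => [x y] [z t] /= sp0.
by simpc; congr Complex; field.
Qed.

Lemma chord_arc n :
  0 < s * orient (T (w n + 1)) (chord * e n) (T (w n - 1)).
Proof.
have [t t0 ->] := chord_forward n; have [k _ ->] := q_side n.
set a := T _; set b := T _.
have -> : orient a (k%:C%C * a + (1 - k)%:C%C * b + t%:C%C * e n) b = t * cross (e n) (b - a).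
  rewrite /orient /cross; case: (e n) a b => [? ?] [? ?] [? ?] /=; ring.
by rewrite mulrCA mulr_gt0 ?outward.
Qed.

Lemma chord_neq0 : chord != 0.
Proof.
by have := on_circle_neq0 (chord_circle 0); apply: contraNneq => ->; rewrite mul0r.
Qed.

(** The label-independent rotation that follows the reflection in the bisector of the side
    crossed. *)
Definition twist : R[i] := - (chord / chord^*).

Lemma twist_unit : twist * twist^* = 1.
Proof.
have c0 := chord_neq0.
rewrite /twist conjcN conjcM conjc_inv conjcK mulrNN.
by field; rewrite c0 conjc_eq0 c0.
Qed.

Lemma chord_step n : chord * e n.+1 = twist * axis (w n) * (chord * e n)^*.
Proof.
have c0 : chord^* != 0 by rewrite conjc_eq0 chord_neq0.
by rewrite e_step /twist conjcM; field.
Qed.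

Lemma folded_odd_period N : (0 < N)%N -> (forall n, e (n + N)%N = e n) ->
  balanced w N -> exists2 j, odd j & forall n, w (n + j)%N = w n.
Proof.
move=> N_gt0 eN bal.
pose pt (z : R[i]) (hz : on_circle z) : circle := exist _ z hz.
have unit l : twist * axis l * (twist * axis l)^* = 1.
  by rewrite conjcM mulrACA twist_unit axis_unit mulr1.
pose X n := pt _ (chord_circle n).
pose Tc l := pt _ (T_circle l).
pose Tc' l := pt _ (on_circle_rotate twist_unit (T_circle l)).
pose F l (z : circle) := pt _ (on_circle_reflect (unit l) (valP z)).
apply: (balanced_exchange_odd_period circle_cyclic_order (x := X) (T := Tc) (T' := Tc') (rho
  := F) N_gt0) => //.
- by move=> n; apply: val_inj => /=; rewrite eN.
- by move=> l; rewrite /ccyc /= T_orient -expr2 exprn_even_gt0.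
- by move=> l; rewrite /ccyc /= orient_rotate ?twist_unit // T_orient -expr2 exprn_even_gt0.
- by move=> n; apply: chord_arc.
- by move=> l a b c; rewrite /ccyc /= orient_reflect // orient_swap opprK.
- by move=> l; apply: val_inj; rewrite /= -mulrA axis_succ.
- by move=> l; apply: val_inj; rewrite /= -mulrA axis_pred.
by move=> n; apply: val_inj; rewrite /= chord_step.
Qed.

Lemma e_double_period m : odd m -> (forall n, w (n + m)%N = w n) ->
  forall n, e (n + m.*2)%N = e n.
Proof.
move=> odd_m wm n.
have prod k : e k.+1 * e k = - axis (w k) * speed%:C%C.
  by rewrite e_step mulNr -mulrA [_^* * _]mulrC e_norm mulNr.
(* The product [e k.+1 * e k] depends on the label [w k] only. *)
have ratioS k : e (k.+1 + m)%N / e k.+1 = (e (k + m)%N / e k)^-1.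
  have : e (k + m).+1 * e (k + m)%N = e k.+1 * e k by rewrite !prod wm.
  rewrite addSn invf_div => E; apply/eqP; rewrite eqr_div ?e_neq0 //.
  by rewrite E mulrC.
have ratio k : e (n + k + m)%N / e (n + k)%N =
    if odd k then (e (n + m)%N / e n)^-1 else e (n + m)%N / e n.
  elim: k => [|k IH]; first by rewrite addn0.
  by rewrite addnS ratioS IH /=; case: (odd k); rewrite ?invrK.
(* As [m] is odd, the ratios over the two successive stretches of length [m] are inverse to each
   other. *)
have := ratio m; rewrite odd_m -addnA addnn => /(canRL (divfK (e_neq0 _))) ->.
by rewrite invf_div divfK ?e_neq0.
Qed.

(** Equal moments put both exit points on one line, which by [outward] is transverse to the side and
    meets it once. *)
Lemma q_eq i j : w i = w j -> e i = e j -> q i = q j.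
Proof.
move=> wij eij; have := momentE i; rewrite -(momentE j) -eij.
have := outward i; have [k _ ->] := q_side i; have [k' _ ->] := q_side j.
rewrite -wij; set a := T (w i + 1); set b := T (w i - 1) => out E.
suff -> : k = k' by [].
have : (k' - k) * cross (e i) (b - a) = 0.
  by move: E; rewrite !crossDr crossNr !crossZr => E; lra.
move/eqP; rewrite mulf_eq0 => /orP[|/eqP E0]; first by rewrite subr_eq0 => /eqP.
by move: out; rewrite E0 mulr0 ltxx.
Qed.

End FoldedTrajectory.
End Circle.

(** * The plane as the complex line *)

Section PlaneAsComplex.
Variable R : realType.
Implicit Types (u v x : plane R) (V W : tile R).
Local Notation "z ^*" := (conjc z) : ring_scope.

Definition cpx u : R[i] := (u 0 0 +i* u 0 1)%C.

Lemma cpxD u v : cpx (u + v) = cpx u + cpx v.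
Proof. by rewrite /cpx !mxE. Qed.

Lemma cpxZ (k : R) u : cpx (k *: u) = k%:C%C * cpx u.
Proof. by rewrite /cpx !mxE; simpc. Qed.

Lemma cpxN u : cpx (- u) = - cpx u.
Proof. by rewrite /cpx !mxE. Qed.

Lemma cpx0 : cpx 0 = 0.
Proof. by rewrite /cpx !mxE. Qed.

Lemma cpxB u v : cpx (u - v) = cpx u - cpx v.
Proof. by rewrite cpxD cpxN. Qed.

Lemma cpx_inj : injective cpx.
Proof.
move=> u v [u0 u1]; apply/rowP => i.
by case: i => [[|[|//]] i]; [have := u0 | have := u1]; congr (_ = _); congr (_ _ _);
  apply/val_inj.
Qed.

Lemma cpx_lincomb V (k : label -> R) l : cpx (\sum_i k i *: V i) =
  (k l)%:C%C * cpx (V l) + (k (l + 1))%:C%C * cpx (V (l + 1)) + (k (l - 1))%:C%C * cpx (V (l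
    - 1)).
Proof. by rewrite (sum_label _ l) !cpxD !cpxZ. Qed.

Lemma dotE u v : dot u v = u 0 0 * v 0 0 + u 0 1 * v 0 1.
Proof. by rewrite /dot !big_ord_recl big_ord0 addr0; congr (_ * _ + _ * _); congr (_ _ _);
  apply/val_inj. Qed.

(** Refraction with coefficient -1 is minus the reflection in the line spanned by [u]. *)
Lemma cpx_refract u v : u != 0 ->
  cpx (refract u v) * (cpx u)^* = - ((cpx v)^* * cpx u).
Proof.
move=> u0; have d0 : u 0 0 ^+ 2 + u 0 1 ^+ 2 != 0.
  rewrite paddr_eq0 ?sqr_ge0 // !sqrf_eq0; apply: contra u0 => /andP[/eqP h0 /eqP h1].
  by apply/eqP/cpx_inj; rewrite /cpx !mxE h0 h1.
rewrite /refract /normal_part /tangent_part !(cpxB, cpxZ) /cpx !dotE -!expr2.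
move: d0; set a := u 0 0; set b := u 0 1; set x := v 0 0; set y := v 0 1 => d0.
by simpc; congr Complex; field.
Qed.

Lemma barycentric_uniq V k k' x : Defs.nondegenerate V ->
  barycentric V k x -> barycentric V k' x -> k =1 k'.
Proof.
move=> nd [k1 ->] [k1' E] l; apply/eqP; rewrite -subr_eq0; apply/eqP.
apply: (nd (fun l => k l - k' l)); first by rewrite sumrB k1 k1' subrr.
by under eq_bigr do rewrite scalerBl; rewrite sumrB E subrr.
Qed.

Lemma open_side_uniq V l m x : Defs.nondegenerate V ->
  open_side V l x -> open_side V m x -> l = m.
Proof.
move=> nd [k bk [kl kpos]] [k' bk' [km kpos']]; apply/eqP; apply: contraT => lm.
by have := kpos' _ lm; rewrite -(barycentric_uniq nd bk bk') kl ltxx.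
Qed.

Lemma open_side_convex V l x y (t : R) : Defs.nondegenerate V -> 
  open_side V l x -> open_side V l y -> ~ open_triangle V ((1 - t) *: x + t *: y).
Proof.
move=> nd [k [k1 ->] [kl _]] [k' [k1' ->] [kl' _]] [h bh hpos].
pose g j := (1 - t) * k j + t * k' j.
have bg : barycentric V g ((1 - t) *: (\sum_j k j *: V j) + t *: (\sum_j k' j *: V j)).
  split; first by rewrite big_split /= -!mulr_sumr k1 k1'; ring.
  rewrite !scaler_sumr -big_split; apply: eq_bigr => j _ /=.
  by rewrite !scalerA -scalerDl.
by have := hpos l; rewrite -(barycentric_uniq nd bg bh) /g kl kl' !mulr0 addr0 ltxx.
Qed.

Lemma open_side_cpx V l x : open_side V l x -> exists2 k : R, 0 < k < 1 &
  cpx x = k%:C%C * cpx (V (l + 1)) + (1 - k)%:C%C * cpx (V (l - 1)).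
Proof.
case=> k [k1 ->] [kl kpos]; rewrite (sum_label _ l) kl add0r in k1.
have ne1 : l + 1 != l by case: l {kpos k1 kl} => [[|[|[|//]]] i].
have ne2 : l - 1 != l by case: l {kpos k1 kl ne1} => [[|[|[|//]]] i].
have := kpos _ ne1; have := kpos _ ne2 => h2 h1.
exists (k (l + 1)); first by rewrite h1 -k1 ltrDl h2.
by rewrite (cpx_lincomb _ _ l) kl mul0r add0r -k1 addrAC subrr add0r.
Qed.

Lemma nondegenerate_cpx V (k0 k1 k2 : R) : Defs.nondegenerate V -> k0 + k1 + k2 = 0 ->
  k0%:C%C * cpx (V 0) + k1%:C%C * cpx (V 1) + k2%:C%C * cpx (V (- 1)) = 0 ->
  [/\ k0 = 0, k1 = 0 & k2 = 0].
Proof.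
move=> nd ks kV; pose k (l : label) := nth 0 [:: k0; k1; k2] l.
have k_eq0 : forall l, k l = 0.
  apply: nd; first by rewrite (sum_label _ 0).
  apply: cpx_inj; rewrite (cpx_lincomb _ _ 0) add0r sub0r.
  by rewrite [k 0]/= [k 1]/= [k (-1)]/= kV /cpx !mxE.
by split; [exact: (k_eq0 0) | exact: (k_eq0 1) | exact: (k_eq0 (-1))].
Qed.

Lemma nondegenerate_orient V : Defs.nondegenerate V ->
  orient (cpx (V 0)) (cpx (V 1)) (cpx (V (-1))) != 0.
Proof.
move=> nd; apply/eqP; have dep k0 k1 k2 := nondegenerate_cpx (k0 := k0) (k1 := k1) (k2 := k2)
  nd.
move: dep; rewrite /orient /cross /cpx; simpc; rewrite /=.
set a0 := V 0 0 0; set a1 := V 0 0 1; set b0 := V 1 0 0; set b1 := V 1 0 1.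
set c0 := V (-1) 0 0; set c1 := V (-1) 0 1 => dep D.
(* If the determinant vanishes, differences of one coordinate are the coefficients of an affine
   relation. *)
have [] := dep (b1 - c1) (c1 - a1) (a1 - b1); first by ring.
  by congr Complex; [rewrite -[RHS]D; ring | ring].
have [] := dep (b0 - c0) (c0 - a0) (a0 - b0); first by ring.
  by congr Complex; [ring | apply: oppr_inj; rewrite oppr0 -[RHS]D; ring].
move=> _ /subr0_eq ca0 /subr0_eq ab0 _ /subr0_eq ca1 /subr0_eq ab1.
have [] := dep 1 (-1) 0; first by ring.
  by rewrite -ab0 -ab1; congr Complex; ring.
by move=> /eqP; rewrite oner_eq0.
Qed.

Lemma circumcenter (a b c : R[i]) : orient a b c != 0 ->
  exists o (rho : R), [/\ 0 < rho, on_circle rho (a - o), on_circle rho (b - o) & on_circle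
    rho (c - o)].
Proof.
case: a b c => [a0 a1] [b0 b1] [c0 c1]; rewrite /orient /cross /=; set D := _ - _ => D0.
pose X := (b0 - a0) ^+ 2 + (b1 - a1) ^+ 2; pose Y := (c0 - a0) ^+ 2 + (c1 - a1) ^+ 2.
(* Cramer's rule for the centre relative to [a], from the bisector equations [hX] and [hY]. *)
pose p := (X * (c1 - a1) - Y * (b1 - a1)) / (2 * D).
pose r := (Y * (b0 - a0) - X * (c0 - a0)) / (2 * D).
have hX : X = 2 * ((b0 - a0) * p + (b1 - a1) * r) by rewrite /p /r /X /Y /D; field.
have hY : Y = 2 * ((c0 - a0) * p + (c1 - a1) * r) by rewrite /p /r /X /Y /D; field.
exists ((a0 + p) +i* (a1 + r))%C, (p ^+ 2 + r ^+ 2).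
have circ (x y : R) : (x - a0) ^+ 2 + (y - a1) ^+ 2 = 2 * ((x - a0) * p + (y - a1) * r) ->
    on_circle (p ^+ 2 + r ^+ 2) ((x +i* y)%C - ((a0 + p) +i* (a1 + r))%C).
  move=> h; rewrite /on_circle; simpc; rewrite eq_complex /=; apply/andP; split; apply/eqP;
    last by ring.
  by apply: (addIr (2 * ((x - a0) * p + (y - a1) * r))); rewrite -{2}h; ring.
split; [|by apply: circ; ring|exact: circ hX|exact: circ hY].
rewrite lt0r addr_ge0 ?sqr_ge0 // andbT paddr_eq0 ?sqr_ge0 // !sqrf_eq0.
apply: contra D0 => /andP[/eqP p0 /eqP r0].
move: hX; rewrite p0 r0 !mulr0 addr0 mulr0 => /eqP.
rewrite /X paddr_eq0 ?sqr_ge0 // !sqrf_eq0 /D => /andP[/eqP -> /eqP ->].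
by rewrite !mul0r subrr.
Qed.

End PlaneAsComplex.

(** * Folding a trajectory *)

Section TilingTrajectory.
Variables (R : realType) (tau : set (tile R)).
Hypothesis htau : periodic_triangle_tiling tau.
Variables (V : nat -> tile R) (p d : nat -> plane R) (w : nat -> label).
Hypothesis htraj : trajectory tau V p d w.
Local Notation "z ^*" := (conjc z) : ring_scope.

Lemma tile_nondegenerate n : Defs.nondegenerate (V n).
Proof. exact: (tiling_nondegenerate htau) (trajectory_tile htraj n). Qed.

Lemma tile_step n l : V n.+1 l = V n (w n + 1) + V n (w n - 1) - V n l.
Proof.
have -> := tiling_symmetric htau (trajectory_tile htraj n) (trajectory_tile htraj n.+1)
  (trajectory_neighbour htraj n) l.
by rewrite /central_symmetry /midpoint scalerA mulfV ?scale1r ?pnatr_eq0.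
Qed.

Lemma entry_side n : open_side (V n.+1) (w n) (p n).
Proof.
have [k [k1 ->] [kl kpos]] := trajectory_crossing htraj n; set l := w n in kl kpos *.
have El : l + l - l = l by rewrite addrK.
have Es : l + l - (l + 1) = l - 1 by rewrite opprD addrA addrK.
have Ep : l + l - (l - 1) = l + 1 by rewrite opprB addrC addrA subrK addrC.
(* This involution fixes [l] and swaps the two other labels, as the central symmetry swaps the ends
   of the side. *)
exists (fun j => k (l + l - j)).
  split; first by rewrite -k1 !(sum_label _ l) El Es Ep addrAC.
  rewrite !(sum_label _ l) El Es Ep kl !scale0r !add0r !tile_step -/l addrC.
  by rewrite addrK [V n (l + 1) + _]addrC addrK.
split; first by rewrite El.
move=> m ml; apply: kpos; apply: contra ml => /eqP E; apply/eqP.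
by rewrite -(subKr (l + l) m) E El.
Qed.

(** Leaving by the side of entry would keep the whole segment on that side. *)
Lemma label_neq n : w n.+1 <> w n.
Proof.
move=> E; have := trajectory_crossing htraj n.+1; rewrite E => h.
have half : 0 < (2^-1 : R) < 1 by rewrite invr_gt0 ltr0n invf_lt1 ?ltr1n ?ltr0n.
exact: (open_side_convex (@tile_nondegenerate _) (entry_side n) h (trajectory_inside htraj n
  half)).
Qed.

(** The two tiles share the middle of a segment as an interior point. Crossing points only locate
    tiles from index 1 on. *)
Lemma closes_tile N : (forall n, p (n + N)%N = p n) ->
  forall n, V (n + N).+1 = V n.+1.
Proof.
move=> pN n; have [//|ne] := pselect (V (n + N).+1 = V n.+1).
have half : 0 < (2^-1 : R) < 1 by rewrite invr_gt0 ltr0n invf_lt1 ?ltr1n ?ltr0n.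
have h1 := trajectory_inside htraj n half.
have := trajectory_inside htraj (n + N) half; rewrite -addSn !pN => h2.
have := tiling_disjoint htau (trajectory_tile htraj _) (trajectory_tile htraj _) ne.
by rewrite -[set0]/(_) => /seteqP[/(_ _ (conj h2 h1))].
Qed.

Lemma closes_label N : (forall n, p (n + N)%N = p n) -> forall n, w (n + N)%N = w n.
Proof.
move=> pN n; apply: (open_side_uniq (@tile_nondegenerate n.+1) (x := p n)).
  by rewrite -(closes_tile pN) -(pN n); apply: entry_side.
exact: entry_side.
Qed.

Local Notation sg n := (((-1) ^+ n)%:C%C : R[i]).

Lemma sgS n : sg n.+1 = - sg n.
Proof. by rewrite exprS mulN1r rmorphN. Qed.

Lemma sg_sq n : sg n * sg n = 1.
Proof. by rewrite -rmorphM -expr2 sqrr_sign. Qed.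

Variables (o : R[i]) (rho : R).
Hypothesis rho_gt0 : 0 < rho.
Hypothesis o_circle : forall l, on_circle rho (cpx (V 0%N l) - o).

Definition vertex l : R[i] := cpx (V 0%N l) - o.
(** The circumcentre of the n-th tile, which is a translate of [T] for even [n] and of [- T] for odd
    [n], see [tileE]. *)
Definition center n : R[i] := cpx (V n 0) - sg n * vertex 0.
Definition direction n : R[i] := sg n * cpx (d n).
Definition position n : R[i] := sg n * (cpx (p n) - center n).
Definition orientation : R := orient (vertex 0) (vertex 1) (vertex (- 1)).

Local Notation T := vertex.
Local Notation e := direction.
Local Notation q := position.

Lemma tileE n l : cpx (V n l) = center n + sg n * T l.
Proof.
suff : cpx (V n l) - cpx (V n 0) = sg n * (T l - T 0).
  by rewrite mulrBr /center => /(canRL (subrK _)) ->; ring.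
elim: n => [|n IH]; first by rewrite mul1r /vertex; ring.
by rewrite !tile_step !cpxB sgS mulNr -IH; ring.
Qed.

Lemma centerS n : center n.+1 = center n + sg n * (T (w n + 1) + T (w n - 1)).
Proof.
rewrite {1}/center tile_step cpxB cpxD !tileE sgS; ring.
Qed.

Lemma vertex_orient l : orient (T l) (T (l + 1)) (T (l - 1)) = orientation.
Proof.
rewrite /orientation; case: (label_cases 0 l) => ->; rewrite ?add0r ?sub0r //.
  rewrite subrr orientC (_ : 1 + 1 = -1 :> label) //; exact/val_inj.
by rewrite addrC subrr -[RHS]orientC -[RHS]orientC (_ : -1 - 1 = 1 :> label) //; exact/val_inj.
Qed.

Lemma orientation_neq0 : orientation != 0.
Proof.
have := nondegenerate_orient (@tile_nondegenerate 0).
by rewrite /orientation /vertex orient_translate.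
Qed.

Lemma sg_conj n : (sg n)^* = sg n.
Proof. exact: conjc_real. Qed.

(** For [a], [b] on the circle, [a - b] divided by its conjugate is [- (a * b) / rho], so
    [cpx_refract] becomes [axis]; the alternating sign gives the minus. *)
Lemma direction_step n : e n.+1 = - (axis rho T (w n) * (e n)^* ).
Proof.
set a := T (w n + 1); set b := T (w n - 1).
have uE : cpx (side_vector (V n) (w n)) = sg n * (a - b).
  by rewrite /side_vector cpxB !tileE -/a -/b; ring.
have ab : a - b != 0.
  rewrite subr_eq0; apply: contraNneq orientation_neq0;
    rewrite -(vertex_orient (w n)) -orientC -/a -/b => ->.
  by rewrite /orient subrr /cross !mul0r subrr.
have sg0 : sg n != 0 by rewrite (inj_eq (@complexI R) _ 0) signr_eq0.
have u0 : side_vector (V n) (w n) != 0.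
  apply/eqP => h; move/eqP: uE; rewrite h cpx0 eq_sym mulf_eq0 (negbTE ab) orbF.
  by rewrite (negbTE sg0).
have := cpx_refract (d n) u0; rewrite -(trajectory_refract htraj) uE.
have [ha hb] : on_circle rho a /\ on_circle rho b by split; apply: o_circle.
have [a0 b0] : a != 0 /\ b != 0 by split; [exact: on_circle_neq0 ha|exact: on_circle_neq0 hb].
have r0 : rho%:C%C != 0 :> R[i] by rewrite (inj_eq (@complexI R) _ 0) gt_eqF.
rewrite conjcM sg_conj conjcB (on_circle_conj rho_gt0 ha) (on_circle_conj rho_gt0 hb) => H.
suff E : cpx (d n.+1) = a * b / rho%:C%C * (cpx (d n))^*.
  by rewrite /direction E sgS conjcM sg_conj /axis -/a -/b; ring.
apply: (@mulIf _ (sg n * (rho%:C%C / a - rho%:C%C / b))); last first.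
  by rewrite H; field; rewrite a0 b0 r0.
rewrite mulf_neq0 // (_ : _ - _ = rho%:C%C * (b - a) / (a * b)); last by field; rewrite a0 b0.
rewrite !mulf_neq0 ?invr_eq0 ?mulf_neq0 //.
by rewrite -opprB oppr_eq0.
Qed.

Lemma position_side n : exists2 k : R, 0 < k < 1 &
  q n = k%:C%C * T (w n + 1) + (1 - k)%:C%C * T (w n - 1).
Proof.
have [k k01 E] := open_side_cpx (trajectory_crossing htraj n).
exists k => //; rewrite /position E !tileE rmorphB rmorph1.
have := sg_sq n; set g := sg n => gg.
rewrite (_ : _ - center n = g * (k%:C%C * T (w n + 1) + (1 - k%:C%C) * T (w n - 1))).
  by rewrite mulrA gg mul1r.
by ring.
Qed.

(** The change of tile and the reflection both exchange the ends of the side crossed, hence agree on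
    the side. *)
Lemma position_reflect n : sg n.+1 * (cpx (p n) - center n.+1) = axis rho T (w n) * (q n)^*.
Proof.
rewrite centerS sgS; have [k k01 E] := position_side n.
have {1}-> : cpx (p n) = center n + sg n * q n.
  by rewrite /position mulrA sg_sq mul1r addrC subrK.
rewrite E conjcD !conjcM !conjc_real [in RHS]mulrDr ![axis _ _ _ * (_ * _)]mulrCA.
rewrite (axis_succ rho_gt0) ?(axis_pred rho_gt0) //; try exact: o_circle.
rewrite rmorphB rmorph1; have := sg_sq n; set g := sg n => gg.
set a := T _; set b := T _; set kc := k%:C%C.
transitivity (- (g * g) * (kc * a + (1 - kc) * b - (a + b))); first by ring.
by rewrite gg; ring.
Qed.

Lemma position_step n : exists t : R,
  q n.+1 = axis rho T (w n) * (q n)^* + t%:C%C * e n.+1.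
Proof.
have [t _ E] := trajectory_straight htraj n; exists t.
rewrite -position_reflect /position E cpxD cpxZ /direction; ring.
Qed.

Lemma direction_cross n :
  cross (e n.+1) (T (w n - 1) - T (w n + 1)) = - cross (e n) (T (w n - 1) - T (w n + 1)).
Proof.
have hs : axis rho T (w n) * (T (w n + 1))^* = T (w n - 1) := axis_succ rho_gt0 o_circle (w n).
have hp : axis rho T (w n) * (T (w n - 1))^* = T (w n + 1) := axis_pred rho_gt0 o_circle (w n).
set u := T (w n - 1) - T (w n + 1).
have hu : u = - (axis rho T (w n) * u^* ) by rewrite conjcB mulrBr hs hp opprB.
rewrite {1}hu direction_step crossN crossNr opprK crossM.
have -> : axis rho T (w n) * (axis rho T (w n))^* = 1 := axis_unit rho_gt0 o_circle (w n).
by rewrite mul1r cross_conj.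
Qed.

(** Halfway along the next segment the coordinate [K] at the vertex opposite to the side is
    positive, so [e n.+1] points inward; [direction_cross] carries this back to [e n]. *)
Lemma direction_outward n : 0 < orientation * cross (e n) (T (w n - 1) - T (w n + 1)).
Proof.
have half : 0 < (2^-1 : R) < 1 by rewrite invr_gt0 ltr0n invf_lt1 ?ltr1n ?ltr0n.
have [k [k1 kE] kpos] := trajectory_inside htraj n half.
have [t t0 pE] := trajectory_straight htraj n.
have [k' _ k'E] := open_side_cpx (entry_side n).
move: kE k'E; rewrite pE => /(congr1 (@cpx R));
  rewrite (cpx_lincomb _ _ (w n)) cpxD !cpxZ cpxD cpxZ !tileE.
rewrite (sum_label _ (w n)) in k1.
have := kpos (w n); move: k1.
set l := w n; set K := k l; set K1 := k (l + 1); set K2 := k (l - 1).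
set a := T (l + 1); set b := T (l - 1); set c := T l => k1 K0.
set P := cpx (p n); set D := cpx (d n.+1) => E1 E2.
have E : (t / 2)%:C%C * e n.+1 = K%:C%C * (c - a) + (K2 - 1 + k')%:C%C * (b - a).
  have K1E : K1 = 1 - K - K2 by rewrite -k1; ring.
  have {}E1 : (t / 2)%:C%C * D = (K%:C%C * c + K1%:C%C * a + K2%:C%C * b - k'%:C%C * a - (1 -
    k')%:C%C * b) * sg n.+1.
    have -> : (t / 2)%:C%C * D = (1 - 2^-1)%:C%C * P + 2^-1%:C%C * (P + t%:C%C * D) - P.
      by rewrite !(rmorphB, rmorph1, rmorphM); ring.
    by rewrite E1 E2 K1E !(rmorphB, rmorph1); ring.
  rewrite /direction mulrCA E1 mulrC -mulrA sg_sq mulr1 K1E !(rmorphD, rmorphB, rmorphN,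
    rmorph1); ring.
have := congr1 (fun z => cross z (b - a)) E.
rewrite crossZl direction_cross -/l -/a -/b; set X := cross (e n) _.
rewrite crossDl !crossZl.
have -> : cross (c - a) (b - a) = - orientation.
  by rewrite -(vertex_orient l) -/a -/b -/c -orientC /orient crossC.
rewrite [cross (b - a) _](_ : _ = 0); last by rewrite /cross mulrC subrr.
move=> {}E.
have t2 : 0 < t / 2 by rewrite divr_gt0 ?ltr0n.
rewrite -(pmulr_rgt0 _ t2) mulrCA (_ : t / 2 * X = K * orientation); last by lra.
by rewrite mulrCA mulr_gt0 // -expr2 exprn_even_gt0 //= orientation_neq0.
Qed.

Lemma direction_stepV n : e n = - (axis rho T (w n) * (e n.+1)^* ).
Proof.
rewrite direction_step conjcN conjcM conjcK mulrN opprK mulrA.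
have -> : axis rho T (w n) * (axis rho T (w n))^* = 1 := axis_unit rho_gt0 o_circle (w n).
by rewrite mul1r.
Qed.

Lemma positionE n : cpx (p n) = center n + sg n * q n.
Proof. by rewrite /position mulrA sg_sq mul1r addrC subrK. Qed.

Lemma double_period_closes m : odd m -> (forall n, w (n + m)%N = w n) ->
  forall n, p (n + m.*2)%N = p n.
Proof.
move=> odd_m wm n; apply: cpx_inj; rewrite !positionE.
have sg2 : sg (n + m.*2) = sg n by rewrite exprD -muln2 exprM sqrr_sign mulr1.
have sgm k : sg (k + m) = - sg k by rewrite exprD -(signr_odd _ m) odd_m expr1 mulrN1 rmorphN.
(* The n-th and (n+m)-th tiles are centrally symmetric about a fixed point. *)
have sumC k : center (n + k + m)%N + center (n + k)%N = center (n + m)%N + center n.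
  elim: k => [|k IH]; first by rewrite addn0.
  by rewrite addnS addSn !centerS wm sgm -IH; ring.
have -> : center (n + m.*2)%N = center n.
  by have := sumC m; rewrite -addnA addnn addrC => /addrI.
rewrite sg2; congr (_ + _ * _); apply: (q_eq rho_gt0 o_circle direction_step position_side
  position_step direction_outward).
  by rewrite -addnn addnA !wm.
exact: (e_double_period rho_gt0 o_circle direction_step direction_outward odd_m wm).
Qed.

Section Closing.
Variable N : nat.
Hypothesis pN : forall n, p (n + N)%N = p n.

(** An edge vector of the tile changes sign at each crossing and must recur. *)
Lemma closes_even : ~~ odd N.
Proof.
have T10 : T 1 - T 0 != 0.
  rewrite subr_eq0; apply: contraNneq orientation_neq0; rewrite /orientation => ->.
  by rewrite /orient subrr /cross !mul0r subrr.
have step k : cpx (V k 1) - cpx (V k 0) = sg k * (T 1 - T 0) by rewrite !tileE; ring.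
have := step N.+1; rewrite -(add0n N) (closes_tile pN) step add0n => /(mulIf T10) /complexI.
rewrite expr1 exprS => /eqP; rewrite mulN1r eqr_opp -signr_odd.
by case: (odd N) => //; rewrite expr1 -addr_eq0 -mulr2n pnatr_eq0.
Qed.

Let sgN n : sg (n + N) = sg n.
Proof. by rewrite exprD -(signr_odd _ N) (negbTE closes_even) mulr1. Qed.

(** Successive crossing points give the direction up to a positive factor, and the conserved norm
    fixes it. They miss [e 0], which is recovered backwards from [e 1]. *)
Lemma closes_direction n : e (n + N)%N = e n.
Proof.
suff E k : e (k + N).+1 = e k.+1.
  by rewrite direction_stepV (closes_label pN) E -direction_stepV.
have [t t0 E1] := trajectory_straight htraj k.
have [t' t'0 E2] := trajectory_straight htraj (k + N)%N.
have {E1 E2} E : t%:C%C * e k.+1 = t'%:C%C * e (k + N).+1.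
  rewrite /direction -addSn sgN [t%:C%C * _]mulrCA [t'%:C%C * _]mulrCA addSn -!cpxZ;
    congr (cpx (_ *: _)).
  by apply: (addrI (p k)); rewrite -E1 -(pN k) -E2 -addSn pN.
have norm := e_norm rho_gt0 o_circle direction_step.
have sp := speed_gt0 direction_outward.
have tt : t = t'.
  have : (t%:C%C * e k.+1) * (t%:C%C * e k.+1)^* =
      (t'%:C%C * e (k + N).+1) * (t'%:C%C * e (k + N).+1)^* by rewrite E.
  rewrite (conjcM t%:C%C) (conjcM t'%:C%C) !conjc_real mulrACA norm [in RHS]mulrACA norm.
  rewrite -!rmorphM => /complexI /(mulIf (lt0r_neq0 sp)) /eqP.
  by rewrite -!expr2 eqrXn2 ?ltW // => /eqP.
move: E; rewrite tt => /(mulfI _) -> //.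
by rewrite (inj_eq (@complexI R) _ 0) gt_eqF.
Qed.

(** Step [j] moves the centre by a signed constant minus [T (w j)]. The constants cancel as [N] is
    even, which leaves an affine relation between the vertices with coefficients [c l]. *)
Lemma closes_balanced : balanced w N.
Proof.
have centerN : center N = center 0.
  have C1 : center N.+1 = center 1.
    by rewrite /center -(add0n N) (closes_tile pN) -addSn sgN.
  move: C1; rewrite !centerS -{2 3}(add0n N) (closes_label pN) -{2}(add0n N) sgN.
  exact: addIr.
have sumC n : center n = center 0 + \sum_(j < n) sg j * (\sum_l T l - T (w j)).
  elim: n => [|n IH]; first by rewrite big_ord0 addr0.
  rewrite centerS IH (big_ord_recr n) /= -[LHS]addrA; congr (_ + (_ + _ * _)).
  by rewrite (sum_label T (w n)); ring.
pose c l : R := \sum_(j < N) (-1) ^+ j *+ (w j == l).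
have sum_c : \sum_l c l = 0.
  transitivity (\sum_(j < N) (-1) ^+ j : R).
    rewrite exchange_big; apply: eq_bigr => j _ /=.
    by rewrite (bigD1 (w j)) //= eqxx big1 ?addr0 // => l /negbTE; rewrite eq_sym => ->.
  transitivity ((\sum_(j < N) (-1) ^+ j : int)%:~R : R).
    by rewrite rmorph_sum; apply: eq_bigr => j _; rewrite rmorph_sign.
  by rewrite sign_total ?closes_even.
have sum_cT : \sum_l (c l)%:C%C * T l = 0.
  have sum_sg : \sum_(j < N) sg j = 0.
    transitivity ((\sum_(j < N) (-1) ^+ j : int)%:~R : R[i]).
      by rewrite rmorph_sum; apply: eq_bigr => j _; rewrite !rmorph_sign.
    by rewrite sign_total ?closes_even.
  have /eqP := sumC N; rewrite centerN -{1}[center 0]addr0 (inj_eq (addrI _)) eq_sym.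
  under eq_bigr do rewrite mulrBr.
  rewrite sumrB -mulr_suml sum_sg mul0r sub0r oppr_eq0 => /eqP E; rewrite -[RHS]E.
  under eq_bigr do rewrite /c rmorph_sum mulr_suml.
  rewrite exchange_big; apply: eq_bigr => j _ /=.
  rewrite (bigD1 (w j)) //= eqxx mulr1n big1 ?addr0 // => l /negbTE.
  by rewrite eq_sym => ->; rewrite mulr0n rmorph0 mul0r.
have c0 : forall l, c l = 0.
  have [] := @nondegenerate_cpx _ (V 0) (c 0) (c 1) (c (-1)) (@tile_nondegenerate 0).
  - by rewrite -sum_c (sum_label c 0) add0r sub0r.
  - have vE l : cpx (V 0%N l) = T l + o by rewrite /vertex subrK.
    move: sum_cT; rewrite (sum_label _ 0) add0r sub0r !vE => E.
    transitivity ((c 0 + c 1 + c (-1))%:C%C * o); last first.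
      by move: sum_c; rewrite (sum_label c 0) add0r sub0r => ->; rewrite rmorph0 mul0r.
    by rewrite !rmorphD -[LHS]subr0 -[X in _ - X]E; ring.
  by move=> h0 h1 h2 l; case: (label_cases 0 l) => ->; rewrite ?add0r ?sub0r.
move=> l; apply/eqP; rewrite -(intr_eq0 R) rmorph_sum /= -[X in _ == X](c0 l); apply/eqP.
by apply: eq_bigr => j _; rewrite rmorphMn rmorph_sign.
Qed.

End Closing.
End TilingTrajectory.

(** * Periodic words and the conclusion *)

Lemma periodic_word_mkseq (w : nat -> label) m : (0 < m)%N ->
  (forall n, w (n + m)%N = w n) -> w =1 periodic_word (mkseq w m).
Proof.
move=> m_gt0 wm n; rewrite /periodic_word size_mkseq nth_mkseq ?ltn_mod //.
by rewrite {1}(divn_eq n m) addnC (period_mul wm).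
Qed.

Lemma periodic_word_period (w : nat -> label) u :
  w =1 periodic_word u -> forall n, w (n + size u)%N = w n.
Proof. by move=> wu n; rewrite !wu /periodic_word modnDr. Qed.

Local Close Scope ring_scope.

Theorem theorem12 (R : realType) (tau : set (tile R))
    (htau : periodic_triangle_tiling tau)
    (V : nat -> tile R) (p d : nat -> plane R) (w : nat -> label)
    (htraj : trajectory tau V p d w)
    (N : nat) (hN : period p N) :
  (exists n : nat, (0 < n)%N /\ N = (4 * n + 2)%N) /\
  (exists s : seq label,
     [/\ smallest_period w s,
         odd (size s),
         mkseq w N = s ++ s &
         w =1 periodic_word (s ++ s)]).
Proof.
have [[N_gt0 pN] N_min] := hN.
have [o [rho [rho_gt0 h0 h1 h2]]] :=
  circumcenter (nondegenerate_orient (@tile_nondegenerate _ _ htau _ _ _ _ htraj 0)).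
have o_circle l : on_circle rho (cpx (V 0 l) - o)%R.
  by case: (label_cases 0%R l) => ->; rewrite ?add0r ?sub0r.
have wN := closes_label htau htraj pN.
have N_even := closes_even htau htraj o pN.
have [j odd_j wj] := folded_odd_period rho_gt0 (orientation_neq0 htau htraj o) o_circle
  (vertex_orient V o) (direction_step htau htraj rho_gt0 o_circle)
  (position_side htau htraj o) (position_step htau htraj rho_gt0 o_circle)
  (direction_outward htau htraj rho_gt0 o_circle) N_gt0
  (closes_direction htau htraj rho_gt0 o_circle pN) (closes_balanced htau htraj o pN).
have [m [m_gt0 wm m_min]] := minimal_period N_gt0 wN.
have odd_m : odd m := dvdn_odd (m_min j wj) odd_j.
(* [N] is at most [m.*2] by minimality, and both 2 and the odd [m] divide [N]. *)
have NE : N = m.*2.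
  apply/eqP; rewrite eqn_leq N_min /=.
    apply: dvdn_leq => //; rewrite -muln2 Gauss_dvd ?coprimen2 //.
    by rewrite m_min // dvdn2.
  split; first by rewrite double_gt0.
  exact: (double_period_closes htau htraj rho_gt0 o_circle odd_m wm).
have m_neq1 : m != 1.
  by apply/eqP => E; case: (label_neq htau htraj (n := 0)); rewrite -[in RHS](wm 0) E.
have mkE : mkseq w N = mkseq w m ++ mkseq w m.
  rewrite NE -addnn /mkseq iotaD map_cat; congr (_ ++ _).
  by rewrite add0n -[m in iota m _]addn0 iotaDl -map_comp; apply: eq_map => n /=;
    rewrite addnC wm.
split.
  (* With [m] odd, [m.*2] is [4 * m./2 + 2]; [m != 1] makes [m./2] positive. *)
  exists m./2; have := odd_double_half m; rewrite odd_m NE; lia.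
exists (mkseq w m); rewrite size_mkseq; split=> //; last first.
  by rewrite -mkE; apply: periodic_word_mkseq.
split; rewrite ?size_mkseq //; first exact: periodic_word_mkseq.
by move=> u u_gt0 /periodic_word_period /m_min /dvdn_leq; apply.
Qed.
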